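(* Let $p\in[1,\infty]$. The forgetful functor $\overline{U}_p$ from the category of $p$-subadditive commutative metric monoids to the category of metric pairs, given by $(M,d,+,0)\mapsto (M,d,\{0\})$ on objects and by the identity on underlying functions of morphisms, has a left adjoint, given by the functor $\overline{D}_p$ that sends a metric pair $(X,d,A)$ to $(D(X,A),W_p[d,A],+,0)$ and a morphism $f:(X,d,A)\to(Y,d',B)$ to $f_*$.
   Context: A metric space is a pair $(X,d)$ with $X$ a set and $d:X\times X\to[0,\infty]$ satisfying $d(x,x)=0$, $d(x,y)=d(y,x)$ and $d(x,y)\le d(x,z)+d(z,y)$ (an extended pseudometric). A metric map ($1$-Lipschitz map) is a function $f$ with $d_Y(f(x),f(y))\le d_X(x,y)$. A metric pair $(X,d,A)$ is a metric space $(X,d)$ with a nonempty subset $A\subset X$; morphisms $f:(X,d,A)\to(Y,d',B)$ are metric maps with $f(A)\subset B$. A pointed metric space $(X,d,x_0)$ is a metric pair with $A=\{x_0\}$; pointed metric maps are morphisms of these as pairs. The $p$-norms $\|\cdot\|_p$ are the usual ones on finite tuples ($\max$ of absolute values for $p=\infty$), extended to entries in $[0,\infty]$. A $p$-subadditive commutative metric monoid is a tuple $(M,d,+,0)$ with $(M,d,0)$ a pointed metric space and $(M,+,0)$ a commutative monoid such that $d(a+b,a'+b')\le\|(d(a,a'),d(b,b'))\|_p$ for all $a,b,a',b'\in M$. Its morphisms are pointed metric maps that are monoid homomorphisms. $D(X)$ is the free commutative monoid on $X$ (finite formal sums of elements of $X$). $D(X,A):=D(X)/D(A)$ is the quotient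 monoid, where $\alpha\sim\beta$ iff $\alpha+\xi=\beta+\eta$ for some $\xi,\eta\in D(A)$; thus $D(X,A)\cong D(X\setminus A)$. For $f:(X,A)\to(Y,B)$, $f_*:D(X,A)\to D(Y,B)$ is $f_*(x_1+\cdots+x_n)=f(x_1)+\cdots+f(x_n)$. The $p$-Wasserstein distance $W_p[d,A]$ on $D(X,A)$ is $$W_p[d,A](x_1+\cdots+x_m,\,x_1'+\cdots+x_n')=\inf\big\|(d(x_k,x'_{\sigma(k)}))_{k=1}^{m+n}\big\|_p,$$ the infimum being over all $x_{m+1},\ldots,x_{m+n},x'_{n+1},\ldots,x'_{n+m}\in A$ and all permutations $\sigma\in\Sigma_{m+n}$. *)

(* Defs.v *)
From HB Require Import structures.
From mathcomp Require Import all_boot all_order all_algebra all_fingroup.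
From mathcomp Require Import finmap multiset generic_quotient.
From mathcomp Require Import all_classical all_reals all_analysis.

Set Implicit Arguments.
Unset Strict Implicit.
Unset Printing Implicit Defensive.

Import Order.TTheory GRing.Theory Num.Theory.

Local Open Scope classical_set_scope.
Local Open Scope ring_scope.
Local Open Scope quotient_scope.

Record category := Category {
  obj :> Type;
  hom : obj -> obj -> Type;
  idm : forall X, hom X X;
  comp : forall X Y Z, hom Y Z -> hom X Y -> hom X Z;
  comp_idl : forall X Y (f : hom X Y), comp (idm Y) f = f;
  comp_idr : forall X Y (f : hom X Y), comp f (idm X) = f;
  comp_assoc : forall X Y Z T (h : hom Z T) (g : hom Y Z) (f : hom X Y),
    comp h (comp g f) = comp (comp h g) f }.

Arguments hom {c} X Y.
Arguments idm {c} X.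
Arguments comp {c X Y Z} g f.

Definition functor_laws (C D : category) (F : C -> D)
    (Fm : forall X Y : C, hom X Y -> hom (F X) (F Y)) : Prop :=
  (forall X : C, Fm X X (idm X) = idm (F X)) /\
  (forall (X Y Z : C) (g : hom Y Z) (f : hom X Y),
     Fm X Z (comp g f) = comp (Fm Y Z g) (Fm X Y f)).

Record functor (C D : category) := Functor {
  fobj :> C -> D;
  fmap : forall X Y : C, hom X Y -> hom (fobj X) (fobj Y);
  fmapP : functor_laws fmap }.

Arguments Functor {C D fobj fmap} fmapP.
Arguments fmap {C D} f {X Y}.

Definition left_adjoint (C D : category) (F : functor C D) (G : functor D C)
    : Prop :=
  exists phi : forall (X : C) (Y : D), hom (F X) Y -> hom X (G Y),
    (forall X Y, bijective (phi X Y)) /\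
    (forall (X X' : C) (Y Y' : D)
            (f : hom X' X) (g : hom Y Y') (h : hom (F X) Y),
       phi X' Y' (comp g (comp h (fmap F f))) =
       comp (fmap G g) (comp (phi X Y h) f)).

(* The statement only uses [1 <= p]; the value at [p = -oo] is a dummy. *)
Definition pnorm (R : realType) (p : \bar R) (v : seq (\bar R)) : \bar R :=
  match p with
  | r%:E => ((\sum_(x <- v) `|x| `^ r) `^ r^-1)%E
  | +oo%E => (\big[maxe/0]_(x <- v) `|x|)%E
  | -oo%E => 0%E
  end.

(* Extended pseudometrics: infinite distances and distinct points at distance 0
   are allowed. *)
Definition is_metric (R : realType) (T : Type) (d : T -> T -> \bar R) : Prop :=
  [/\ forall x y, (0 <= d x y)%E,
      forall x, d x x = 0%E,
      forall x y, d x y = d y x &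
      forall x y z, (d x y <= d x z + d z y)%E].

Definition is_metric_map (R : realType) (T S : Type)
    (d : T -> T -> \bar R) (e : S -> S -> \bar R) (f : T -> S) : Prop :=
  forall x y, (e (f x) (f y) <= d x y)%E.

(* Carriers are choiceTypes because the formal sums below are {mset X}; classically
   every type has such a structure, and morphisms ignore it. *)
Record metric_pair (R : realType) := MetricPair {
  pt :> choiceType;
  pdist : pt -> pt -> \bar R;
  psub : set pt;
  pdistP : is_metric pdist;
  psub_neq0 : psub !=set0 }.

Arguments pdist {R} m.
Arguments psub {R} m.

Record pair_hom (R : realType) (X Y : metric_pair R) := PairHom {
  pair_fun :> X -> Y;
  pair_fun_metric : is_metric_map (pdist X) (pdist Y) pair_fun;
  pair_fun_sub : pair_fun @` psub X `<=` psub Y }.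

Lemma pair_hom_ext (R : realType) (X Y : metric_pair R) (f g : pair_hom X Y) :
  (f : X -> Y) = g -> f = g.
Proof.
case: f g => [f f1 f2] [g g1 g2] /= fg; rewrite -{}fg in g1 g2 *.
by congr PairHom; exact: Prop_irrelevance.
Qed.

Section PairCategory.
Variable R : realType.

Fact pair_id_metric (X : metric_pair R) :
  is_metric_map (pdist X) (pdist X) (@idfun X).
Proof. by []. Qed.

Fact pair_id_sub (X : metric_pair R) : @idfun X @` psub X `<=` psub X.
Proof. by rewrite image_id. Qed.

Definition pair_id (X : metric_pair R) : pair_hom X X :=
  PairHom (@pair_id_metric X) (@pair_id_sub X).

Fact pair_comp_metric (X Y Z : metric_pair R)
    (g : pair_hom Y Z) (f : pair_hom X Y) :
  is_metric_map (pdist X) (pdist Z) (g \o f).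
Proof.
by move=> x y; apply: le_trans (pair_fun_metric g _ _) (pair_fun_metric f _ _).
Qed.

Fact pair_comp_sub (X Y Z : metric_pair R)
    (g : pair_hom Y Z) (f : pair_hom X Y) : (g \o f) @` psub X `<=` psub Z.
Proof.
move=> _ [x Ax <-]; apply: (@pair_fun_sub _ _ _ g); exists (f x) => //.
by apply: (@pair_fun_sub _ _ _ f); exists x.
Qed.

Definition pair_comp (X Y Z : metric_pair R)
    (g : pair_hom Y Z) (f : pair_hom X Y) : pair_hom X Z :=
  PairHom (@pair_comp_metric _ _ _ g f) (@pair_comp_sub _ _ _ g f).

Definition MetPair : category.
Proof.
by refine (@Category (metric_pair R) (@pair_hom R) pair_id pair_comp _ _ _) => *;
  apply: pair_hom_ext.
Defined.

End PairCategory.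

Definition is_subadditive (R : realType) (p : \bar R) (M : nmodType)
    (d : M -> M -> \bar R) : Prop :=
  forall a b a' b' : M,
    (d (a + b)%R (a' + b')%R <= pnorm p [:: d a a'; d b b'])%E.

Record metric_monoid (R : realType) (p : \bar R) := MetricMonoid {
  mpt :> nmodType;
  mdist : mpt -> mpt -> \bar R;
  mdistP : is_metric mdist;
  mdist_subadditive : is_subadditive p mdist }.

Arguments mdist {R p} m.
Arguments MetricMonoid {R p mpt mdist} mdistP mdist_subadditive.

Definition is_monoid_hom (M N : nmodType) (f : M -> N) : Prop :=
  f 0 = 0 /\ (forall a b, f (a + b) = f a + f b).

Record monoid_hom (R : realType) (p : \bar R) (M N : metric_monoid p) :=
  MonoidHom {
    monoid_fun :> M -> N;
    monoid_fun_metric : is_metric_map (mdist M) (mdist N) monoid_fun;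
    monoid_funP : is_monoid_hom monoid_fun }.

Arguments MonoidHom {R p M N monoid_fun} monoid_fun_metric monoid_funP.

Lemma monoid_hom_ext (R : realType) (p : \bar R) (M N : metric_monoid p)
  (f g : monoid_hom M N) : (f : M -> N) = g -> f = g.
Proof.
case: f g => [f f1 f2] [g g1 g2] /= fg; rewrite -{}fg in g1 g2 *.
by congr MonoidHom; exact: Prop_irrelevance.
Qed.

Section MonoidCategory.
Variables (R : realType) (p : \bar R).

Fact monoid_id_metric (M : metric_monoid p) :
  is_metric_map (mdist M) (mdist M) (@idfun M).
Proof. by []. Qed.

Fact monoid_idP (M : metric_monoid p) : is_monoid_hom (@idfun M).
Proof. by []. Qed.

Definition monoid_id (M : metric_monoid p) : monoid_hom M M :=
  MonoidHom (@monoid_id_metric M) (@monoid_idP M).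

Fact monoid_comp_metric (M N K : metric_monoid p)
    (g : monoid_hom N K) (f : monoid_hom M N) :
  is_metric_map (mdist M) (mdist K) (g \o f).
Proof.
move=> x y.
by apply: le_trans (monoid_fun_metric g _ _) (monoid_fun_metric f _ _).
Qed.

Fact monoid_compP (M N K : metric_monoid p)
    (g : monoid_hom N K) (f : monoid_hom M N) : is_monoid_hom (g \o f).
Proof.
have [[f0 fD] [g0 gD]] := (monoid_funP f, monoid_funP g).
by split=> [|a b] /=; rewrite ?f0 ?fD ?g0 ?gD.
Qed.

Definition monoid_comp (M N K : metric_monoid p)
    (g : monoid_hom N K) (f : monoid_hom M N) : monoid_hom M K :=
  MonoidHom (@monoid_comp_metric _ _ _ g f) (@monoid_compP _ _ _ g f).

Definition CMetMon : category.
Proof.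
by refine (@Category (metric_monoid p) (@monoid_hom R p)
             monoid_id monoid_comp _ _ _) => *; apply: monoid_hom_ext.
Defined.

Definition U_obj (M : metric_monoid p) : metric_pair R :=
  @MetricPair R M (mdist M) [set 0] (mdistP M) (ex_intro _ 0 erefl).

Fact U_map_sub (M N : metric_monoid p) (f : monoid_hom M N) :
  f @` [set 0] `<=` [set 0].
Proof. by move=> _ [_ -> <-]; case: (monoid_funP f). Qed.

Definition U_map (M N : metric_monoid p) (f : monoid_hom M N) :
    pair_hom (U_obj M) (U_obj N) :=
  @PairHom R (U_obj M) (U_obj N) f (monoid_fun_metric f) (@U_map_sub M N f).

Fact U_laws : @functor_laws CMetMon (MetPair R) U_obj U_map.
Proof. by split=> *; apply: pair_hom_ext. Qed.

Definition U : functor CMetMon (MetPair R) := Functor U_laws.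

End MonoidCategory.

Section RelativeFormalSums.
Variables (X : choiceType) (A : set X).

(* The free commutative monoid [D(X)] is [{mset X}], and [D(A)] is the set of
   multisets supported in [A]. *)
Definition Dsub : set {mset X}%mset := [set xi | forall x, x \in xi -> A x].

Definition Deq (alpha beta : {mset X}%mset) : bool :=
  `[< exists xi eta, [/\ Dsub xi, Dsub eta &
                         alpha `+` xi = beta `+` eta]%mset >].

Lemma Dsub0 : Dsub mset0.
Proof. by move=> x; rewrite in_mset0. Qed.

Lemma DsubD (xi eta : {mset X}%mset) :
  Dsub xi -> Dsub eta -> Dsub (xi `+` eta)%mset.
Proof. by move=> h k x; rewrite in_msetD => /orP[/h|/k]. Qed.

Lemma Deq_refl : reflexive Deq.
Proof. by move=> a; apply/asboolP; exists mset0, mset0; split=> //; exact: Dsub0. Qed.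

Lemma Deq_sym : symmetric Deq.
Proof.
suff H a b : Deq a b -> Deq b a by move=> a b; apply/idP/idP; exact: H.
by move=> /asboolP[xi [eta [? ? e]]]; apply/asboolP; exists eta, xi.
Qed.

Lemma Deq_trans : transitive Deq.
Proof.
move=> b a c /asboolP[x [y [hx hy e1]]] /asboolP[z [t [hz ht e2]]].
apply/asboolP; exists (x `+` z)%mset, (y `+` t)%mset.
split; [exact: DsubD | exact: DsubD | ].
by rewrite msetDA e1 msetDAC e2 -msetDA (msetDC t).
Qed.

Canonical Deq_equiv := EquivRel Deq Deq_refl Deq_sym Deq_trans.

Definition Dquot : Type := {eq_quot Deq}.
HB.instance Definition _ := Choice.on Dquot.
HB.instance Definition _ := Quotient.on Dquot.

Definition Dzero : Dquot := \pi_Dquot mset0.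
Definition Dadd (a b : Dquot) : Dquot := \pi_Dquot (repr a `+` repr b)%mset.

Lemma Dpi_eqP (alpha beta : {mset X}%mset) :
  \pi_Dquot alpha = \pi_Dquot beta <-> Deq alpha beta.
Proof. by split=> [/eqmodP//|h]; apply/eqmodP. Qed.

Lemma Deq_msetD (a a' b b' : {mset X}%mset) :
  Deq a a' -> Deq b b' -> Deq (a `+` b)%mset (a' `+` b')%mset.
Proof.
move=> /asboolP[x [y [hx hy e1]]] /asboolP[z [t [hz ht e2]]].
apply/asboolP; exists (x `+` z)%mset, (y `+` t)%mset.
split; [exact: DsubD | exact: DsubD | ].
by rewrite msetDACA e1 e2 msetDACA.
Qed.

Lemma Deq_repr (alpha : {mset X}%mset) : Deq (repr (\pi_Dquot alpha)) alpha.
Proof. by apply/Dpi_eqP; rewrite reprK. Qed.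

Lemma Dadd_pi (alpha beta : {mset X}%mset) :
  Dadd (\pi_Dquot alpha) (\pi_Dquot beta) = \pi_Dquot (alpha `+` beta)%mset.
Proof. by apply/Dpi_eqP; apply: Deq_msetD; exact: Deq_repr. Qed.

Lemma DaddA : associative Dadd.
Proof.
move=> a b c; rewrite -[a]reprK -[b]reprK -[c]reprK.
move: (repr a) (repr b) (repr c) => {}a {}b {}c.
by rewrite (Dadd_pi b c) (Dadd_pi a b) !Dadd_pi msetDA.
Qed.

Lemma DaddC : commutative Dadd.
Proof. by move=> a b; rewrite /Dadd msetDC. Qed.

Lemma Dadd0 : left_id Dzero Dadd.
Proof. by move=> a; rewrite -[a]reprK; move: (repr a) => {}a; rewrite Dadd_pi mset0D. Qed.

HB.instance Definition _ := GRing.isNmodule.Build Dquot DaddA DaddC Dadd0.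

(* The class of [x_1 + ... + x_n], where [s = [:: x_1; ...; x_n]]. *)
Definition Dsum (s : seq X) : Dquot := \pi_Dquot (seq_mset s).

End RelativeFormalSums.

Arguments Dquot {X} A.
Arguments Dsum {X} A s.

Section Wasserstein.
Variables (R : realType) (p : \bar R) (X : metric_pair R).

(* [s = [:: x_1; ...; x_m]] and [s' = [:: x'_1; ...; x'_n]] are padded by
   elements of [psub X] to words [y], [y'] of common length [m + n]; the lengths
   [n] of [t] and [m] of [t'] are forced by the two equations. *)
Definition wasserstein_word (s s' : seq X) : \bar R :=
  ereal_inf [set r | exists (t t' : seq X)
      (y y' : (size s + size s').-tuple X) (sigma : 'S_(size s + size s')),
    [/\ (forall x, x \in t -> psub X x) /\ (forall x, x \in t' -> psub X x),
        y = s ++ t :> seq X,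
        y' = s' ++ t' :> seq X &
        r = pnorm p [seq pdist X (tnth y k) (tnth y' (sigma k))
                    | k <- enum 'I_(size s + size s')]]].

(* Computed on chosen representatives; independence of this choice is not
   built in. *)
Definition wasserstein (a b : Dquot (psub X)) : \bar R :=
  wasserstein_word (repr a : {mset X}%mset) (repr b : {mset X}%mset).

End Wasserstein.

Arguments wasserstein_word {R} p X s s'.
Arguments wasserstein {R} p X a b.

Definition Dpush (R : realType) (X Y : metric_pair R) (f : pair_hom X Y)
    (a : Dquot (psub X)) : Dquot (psub Y) :=
  Dsum (psub Y) (map f (repr a : {mset X}%mset)).

Section DFunctor.
Variables (R : realType) (p : \bar R).

Definition D_objects_ok : Prop := forall X : metric_pair R,
  is_metric (wasserstein p X) /\ is_subadditive p (wasserstein p X).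

Definition D_obj (H : D_objects_ok) (X : metric_pair R) : metric_monoid p :=
  MetricMonoid (proj1 (H X)) (proj2 (H X)).

Definition D_morphisms_ok : Prop :=
  forall (X Y : metric_pair R) (f : pair_hom X Y),
    is_metric_map (wasserstein p X) (wasserstein p Y) (Dpush f) /\
    is_monoid_hom (Dpush f).

Definition D_map (H : D_objects_ok) (K : D_morphisms_ok)
    (X Y : metric_pair R) (f : pair_hom X Y) :
    monoid_hom (D_obj H X) (D_obj H Y) :=
  @MonoidHom R p (D_obj H X) (D_obj H Y) (Dpush f)
    (proj1 (K X Y f)) (proj2 (K X Y f)).

End DFunctor.

Arguments D_objects_ok {R} p.
Arguments D_morphisms_ok {R} p.

(* Main.v *)
Require Import Defs.
From mathcomp Require Import all_boot all_order all_algebra all_fingroup.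
From mathcomp Require Import finmap multiset generic_quotient.
From mathcomp Require Import all_classical all_reals all_analysis.

Set Implicit Arguments.
Unset Strict Implicit.
Unset Printing Implicit Defensive.

Import Order.TTheory GRing.Theory Num.Theory.

Local Open Scope classical_set_scope.
Local Open Scope ring_scope.

(** Everything about [wasserstein_word] follows once padding is made invisible.
    A list of pairs [l] is a coupling of the words [s] and [s'] when its first
    and second components agree with [s] and [s'], up to order, outside [A]: how
    often, and where, points of [A] occur is left free. The Wasserstein distance
    is the infimum of the costs of couplings ([wasserstein_word_le] and
    [wasserstein_word_ge]). A padding with a permutation is such a coupling.
    Conversely, dropping from a coupling the pairs inside [A * A] does not
    increase its cost and leaves at most one pair for each entry of [s] and [s']
    outside [A]; adding pairs [(a, a)] with [a] in [A] is free, and enough of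
    them turn what is left into a matching of two words of length exactly
    [size s + size s'] ([coupling_square]).

    Couplings see only the entries outside [A], which are precisely what the class
    of a word in [D(X, A)] remembers ([Dsum_eqP]), so the distance does not depend
    on representatives. Swapping, concatenating and mapping couplings give
    symmetry, [p]-subadditivity and the metric property of [f_*]. For the triangle
    inequality, two couplings are glued along the common word, after free diagonal
    pairs have made the middle words equal up to order; the cost of the composite
    is controlled by the triangle inequality of [d] and Minkowski's inequality
    ([coupling_glue]).

    For the adjunction, a metric map [g : X -> M] sending [A] to [0] extends to
    the sum [x_1 + ... + x_n |-> g x_1 + ... + g x_n] and, by additivity, in no other
    way. Iterating [p]-subadditivity, the distance in [M] between two sums is at
    most the [p]-norm of the distances between their terms ([mdist_sum_le]), hence
    at most the cost of any coupling. Conversely [x |-> [x]] is a metric map because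
    [(x, y)] alone couples [x] and [y]. *)

(** * The p-norm on extended real tuples *)

Section PNorm.
Variables (R : realType) (p : \bar R).
Hypothesis hp : (1 <= p)%E.
Implicit Types (u v : seq (\bar R)).

Lemma pnorm_nil : pnorm p [::] = 0%E.
Proof.
case: p hp => [r|_|//] /=; last by rewrite big_nil.
rewrite lee_fin => r1.
by rewrite big_nil poweR0r// gt_eqF// invr_gt0 (lt_le_trans ltr01).
Qed.

Lemma pnorm_ge0 v : (0 <= pnorm p v)%E.
Proof.
case: p => [r||] //=; first exact: poweR_ge0.
by apply: bigmax_ge_id.
Qed.

Lemma pnorm_perm u v : perm_eq u v -> pnorm p u = pnorm p v.
Proof. by move=> e; case: p => [r||] //=; rewrite (perm_big _ e). Qed.

Lemma pnorm_seq1 (a : \bar R) : (0 <= a)%E -> pnorm p [:: a] = a.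
Proof.
move=> a0; case: p hp => [r|_|//] /=; last first.
  by rewrite big_cons big_nil gee0_abs// max_l.
rewrite lee_fin => r1; have r0 : 0 < r by exact: lt_le_trans ltr01 r1.
by rewrite big_seq1 gee0_abs// -poweRrM mulfV ?gt_eqF// poweRe1.
Qed.

(** Norms of blocks: this is what reduces statements on long tuples to the
    two-entry norm that appears in [p]-subadditivity. *)
Lemma pnorm_cat u v : pnorm p (u ++ v) = pnorm p [:: pnorm p u; pnorm p v].
Proof.
have := pnorm_ge0 u; have := pnorm_ge0 v.
case: p hp => [r|_|//] /=; last first.
  move=> v0 u0; rewrite !big_cons big_nil !gee0_abs// (max_l v0).
  elim: u {u0} => [|a u ih]; first by rewrite big_nil max_r.
  by rewrite cat_cons !big_cons ih maxA.
rewrite lee_fin => r1 v0 u0; have r0 : 0 < r by exact: lt_le_trans ltr01 r1.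
rewrite big_cons big_seq1 !gee0_abs// big_cat/=.
by rewrite -!poweRrM !mulVf ?gt_eqF// !poweRe1//; apply: sume_ge0 => x _;
  exact: poweR_ge0.
Qed.

Lemma ler_pnorm (T : eqType) (f g : T -> \bar R) (s : seq T) :
  (forall x, x \in s -> 0 <= f x)%E -> (forall x, x \in s -> f x <= g x)%E ->
  (pnorm p (map f s) <= pnorm p (map g s))%E.
Proof.
move=> f0 fg; have g0 x : x \in s -> (0 <= g x)%E.
  by move=> xs; exact: le_trans (f0 _ xs) (fg _ xs).
case: p hp => [r|_|//] /=; last first.
  rewrite !big_map big_seq; apply: bigmax_le; first exact: bigmax_ge_id.
  move=> x xs; apply: bigmax_sup_seq; [exact: xs | by [] |].
  by rewrite !gee0_abs ?fg ?f0 ?g0.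
rewrite lee_fin => r1; have r0 : 0 < r by exact: lt_le_trans ltr01 r1.
have nn (h : T -> \bar R) :
    ((\sum_(x <- map h s) `|x| `^ r)%E \in `[0%E, +oo%E]%O).
  by rewrite in_itv/= leey andbT; apply: sume_ge0 => x _; exact: poweR_ge0.
apply: gt0_ler_poweR => //; first by rewrite invr_ge0 ltW.
rewrite !big_map big_seq [leRHS]big_seq; apply: lee_sum => x xs.
rewrite !gee0_abs ?f0 ?g0//; apply: gt0_ler_poweR; rewrite ?(ltW r0) ?fg//.
  by rewrite in_itv/= leey f0.
by rewrite in_itv/= leey g0.
Qed.

Lemma pnorm2_le (a b c d : \bar R) : (0 <= a)%E -> (0 <= b)%E ->
  (a <= c)%E -> (b <= d)%E -> (pnorm p [:: a; b] <= pnorm p [:: c; d])%E.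
Proof.
move=> a0 b0 ac bd.
have := @ler_pnorm bool (fun x => if x then a else b)
  (fun x => if x then c else d) [:: true; false].
by apply=> -[].
Qed.

Lemma le_pnorm_cat u v : (pnorm p u <= pnorm p (u ++ v))%E.
Proof.
rewrite pnorm_cat -[X in pnorm _ [:: _; X]](pnorm_seq1 (pnorm_ge0 v)).
rewrite -[leLHS](pnorm_seq1 (pnorm_ge0 u)).
apply: (@le_trans _ _ (pnorm p [:: pnorm p u; 0%E])).
  rewrite -[leLHS]pnorm_seq1 ?pnorm_ge0// -[X in pnorm p [:: _; X]]pnorm_nil.
  by rewrite -pnorm_cat cats0 !pnorm_seq1 ?pnorm_ge0.
by apply: pnorm2_le; rewrite ?pnorm_ge0.
Qed.

Lemma le_mem_pnorm v (x : \bar R) : x \in v -> (0 <= x)%E -> (x <= pnorm p v)%E.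
Proof.
move=> /perm_to_rem e x0; rewrite (pnorm_perm e) -{1}[x]pnorm_seq1//.
exact: (@le_pnorm_cat [:: x]).
Qed.

Lemma pnorm_cat0 u v : pnorm p v = 0%E -> pnorm p (u ++ v) = pnorm p u.
Proof. by move=> v0; rewrite pnorm_cat v0 -pnorm_nil -pnorm_cat cats0. Qed.

Lemma pnorm_map0 (T : Type) (f : T -> \bar R) (s : seq T) :
  (forall x, f x = 0%E) -> pnorm p (map f s) = 0%E.
Proof.
move=> f0; elim: s => [|x s ih]; first exact: pnorm_nil.
by rewrite /= f0 -cat1s (pnorm_cat0 _ ih) pnorm_seq1.
Qed.

(** Convexity of [t |-> t ^ r]: the left-hand base is the average of [x / A]
    and [y / B] with weights [A / (A + B)] and [B / (A + B)]. *)
Lemma powR_add_convex (r A B x y : R) : 1 <= r -> 0 < A -> 0 < B ->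
  0 <= x -> 0 <= y ->
  ((x + y) / (A + B)) `^ r <=
  A / (A + B) * (x / A) `^ r + B / (A + B) * (y / B) `^ r.
Proof.
move=> r1 A0 B0 x0 y0; have AB0 : 0 < A + B by exact: addr_gt0.
have t0 : 0 <= A / (A + B) by rewrite divr_ge0 ?ltW.
have t1 : A / (A + B) <= 1 by rewrite ler_pdivrMr// mul1r lerDl ltW.
have := @convex_powR R r r1 (Itv01 t0 t1) (x / A) (y / B).
rewrite !inE/= !in_itv/= !andbT !divr_ge0// ?(ltW A0) ?(ltW B0)// => /(_ isT isT).
rewrite convRE [X in X `^ _ <= _ -> _]convRE /= /unstable.onem.
have -> : 1 - A / (A + B) = B / (A + B).
  by apply: (mulIf (lt0r_neq0 AB0)); rewrite mulrBl !divfK ?gt_eqF// mul1r addrC addKr.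
have -> // : A / (A + B) * (x / A) + B / (A + B) * (y / B) = (x + y) / (A + B).
rewrite mulrDl; congr (_ + _).
  by rewrite mulrC mulrA divfK// gt_eqF.
by rewrite mulrC mulrA divfK// gt_eqF.
Qed.

(** Minkowski's inequality with upper bounds [A] and [B] in place of the two
    norms. Being positive, they can be divided by, which spares the case of a
    zero norm. *)
Lemma minkowski_powR_sum (T : Type) (s : seq T) (f g : T -> R) (r A B : R) :
  1 <= r -> 0 < A -> 0 < B -> (forall x, 0 <= f x) -> (forall x, 0 <= g x) ->
  \sum_(x <- s) f x `^ r <= A `^ r -> \sum_(x <- s) g x `^ r <= B `^ r ->
  \sum_(x <- s) (f x + g x) `^ r <= (A + B) `^ r.
Proof.
move=> r1 A0 B0 f0 g0 fA gB.
have AB0 : 0 < A + B by exact: addr_gt0.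
have scale (h : T -> R) (C : R) : 0 < C -> (forall x, 0 <= h x) ->
    \sum_(x <- s) h x `^ r <= C `^ r -> \sum_(x <- s) (h x / C) `^ r <= 1.
  move=> C0 h0 hC.
  have -> : \sum_(x <- s) (h x / C) `^ r = (\sum_(x <- s) h x `^ r) / C `^ r.
    rewrite mulr_suml; apply: eq_bigr => x _.
    have C0' := ltW C0; rewrite powRM ?invr_ge0//; congr (_ * _).
    have Cr : C `^ r != 0 by rewrite gt_eqF// powR_gt0.
    by apply: (mulIf Cr); rewrite mulVf// -powRM ?invr_ge0// mulVf ?powR1// gt_eqF.
  by rewrite ler_pdivrMr ?powR_gt0// mul1r.
have -> : \sum_(x <- s) (f x + g x) `^ r =
    (A + B) `^ r * \sum_(x <- s) ((f x + g x) / (A + B)) `^ r.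
  rewrite mulr_sumr; apply: eq_bigr => x _.
  rewrite -powRM ?divr_ge0 ?addr_ge0 ?(ltW A0) ?(ltW B0)//.
  by rewrite mulrC divfK ?gt_eqF.
rewrite -[leRHS]mulr1; apply: ler_pM; rewrite ?powR_ge0//.
  by apply: sumr_ge0 => x _; exact: powR_ge0.
apply: (@le_trans _ _ (A / (A + B) * \sum_(x <- s) (f x / A) `^ r +
                       B / (A + B) * \sum_(x <- s) (g x / B) `^ r)).
  by rewrite !mulr_sumr -big_split; apply: ler_sum => x _; exact: powR_add_convex.
have -> : 1 = A / (A + B) * 1 + B / (A + B) * 1 :> R.
  by rewrite !mulr1 -mulrDl divff// gt_eqF.
by apply: lerD; rewrite ler_wpM2l ?divr_ge0 ?(ltW A0) ?(ltW B0) ?(ltW AB0)// scale.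
Qed.

(** Finite bounds on the norms force the entries of the tuples to be finite,
    which brings the claim back to real numbers. *)
Lemma minkowski_bound (T : eqType) (s : seq T) (f g : T -> \bar R) (A B : R) :
  0 < A -> 0 < B -> (forall x, 0 <= f x)%E -> (forall x, 0 <= g x)%E ->
  (pnorm p (map f s) <= A%:E)%E -> (pnorm p (map g s) <= B%:E)%E ->
  (pnorm p [seq (f x + g x)%E | x <- s] <= (A + B)%:E)%E.
Proof.
move=> A0 B0 f0 g0 fA gB.
have AB0 : 0 < A + B by exact: addr_gt0.
have le (h : T -> \bar R) C : (forall x, 0 <= h x)%E ->
    (pnorm p (map h s) <= C%:E)%E -> forall x, x \in s -> (h x <= C%:E)%E.
  move=> h0 hC x xs; apply: le_trans hC; apply: le_mem_pnorm => //.
  exact: map_f.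
have fAx := le f A f0 fA; have gBx := le g B g0 gB.
case: p hp fA gB => [r|_|//] /=; last first.
  move=> _ _; rewrite big_map big_seq; apply: bigmax_le.
    by rewrite lee_fin ltW.
  by move=> x xs; rewrite gee0_abs ?adde_ge0// EFinD leeD ?fAx ?gBx.
rewrite lee_fin => r1; have r0 : 0 < r by exact: lt_le_trans ltr01 r1.
have rV0 : 0 <= r^-1 by rewrite invr_ge0 ltW.
have fin (h : T -> \bar R) C : (forall x, 0 <= h x)%E ->
    (forall x, x \in s -> h x <= C%:E)%E ->
    forall x, x \in s -> h x = (fine (h x))%:E.
  move=> h0 hC x xs; rewrite fineK// ge0_fin_numE//.
  by rewrite (le_lt_trans (hC _ xs))// ltry.
have normE (h : T -> R) (C : R) : 0 <= C -> (forall x, 0 <= h x) ->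
    ((((\sum_(x <- map (EFin \o h) s) `|x| `^ r) `^ r^-1) <= C%:E)%E =
    (\sum_(x <- s) h x `^ r <= C `^ r)).
  move=> C0 h0.
  have -> : (\sum_(x <- map (EFin \o h) s) `|x| `^ r)%E =
            (\sum_(x <- s) h x `^ r)%:E.
    rewrite big_map -sumEFin; apply: eq_bigr => x _ /=.
    by rewrite ger0_norm.
  have S0 : 0 <= \sum_(x <- s) h x `^ r.
    by apply: sumr_ge0 => x _; exact: powR_ge0.
  rewrite poweR_EFin lee_fin; apply/idP/idP => hC.
    rewrite -[leLHS]powRr1// -(mulVf (lt0r_neq0 r0)) powRrM.
    by apply: ge0_ler_powR; rewrite ?nnegrE ?powR_ge0// ltW.
  rewrite -[leRHS]powRr1// -(mulfV (lt0r_neq0 r0)) powRrM.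
  by apply: ge0_ler_powR; rewrite ?nnegrE ?powR_ge0.
have eqf : map f s = map (EFin \o (fine \o f)) s.
  by apply/eq_in_map => x xs /=; exact: fin fAx _ xs.
have eqg : map g s = map (EFin \o (fine \o g)) s.
  by apply/eq_in_map => x xs /=; exact: fin gBx _ xs.
have eqfg : [seq (f x + g x)%E | x <- s] =
    map (EFin \o (fun x => fine (f x) + fine (g x))) s.
  apply/eq_in_map => x xs /=.
  by rewrite EFinD -(fin f A f0 fAx x xs) -(fin g B g0 gBx x xs).
rewrite eqf eqg eqfg !normE ?(ltW A0) ?(ltW B0) ?(ltW AB0)//.
  move=> Hf Hg; apply: minkowski_powR_sum => //= x; exact: fine_ge0.
all: by move=> x /=; rewrite ?addr_ge0 ?fine_ge0.
Qed.

Lemma minkowski_pnorm (T : eqType) (s : seq T) (f g : T -> \bar R) :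
  (forall x, 0 <= f x)%E -> (forall x, 0 <= g x)%E ->
  (pnorm p [seq (f x + g x)%E | x <- s] <=
   pnorm p (map f s) + pnorm p (map g s))%E.
Proof.
move=> f0 g0; have := pnorm_ge0 (map f s); have := pnorm_ge0 (map g s).
case Ef : (pnorm p (map f s)) => [a| |] //; case Eg : (pnorm p (map g s)) => [b| |] //;
  rewrite ?leey//.
rewrite !lee_fin => b0 a0; apply/lee_addgt0Pr => e e0.
have e20 : 0 < e / 2 by rewrite divr_gt0.
(* The bounds [a + e / 2] and [b + e / 2] are positive even if [a] or [b] is zero. *)
rewrite -!EFinD [e]splitr addrACA; apply: minkowski_bound => //.
- by rewrite ltr_wpDl.
- by rewrite ltr_wpDl.
- by rewrite Ef lee_fin lerDl ltW.
- by rewrite Eg lee_fin lerDl ltW.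
Qed.

(** Enough continuity of the two-entry norm to pass to an infimum in both
    entries. *)
Lemma pnorm2D_le (a b : \bar R) (e : R) : (0 <= a)%E -> (0 <= b)%E -> 0 <= e ->
  (pnorm p [:: a + e%:E; b + e%:E] <= pnorm p [:: a; b] + (e + e)%:E)%E.
Proof.
move=> a0 b0 e0.
have ab0 (c d : \bar R) (x : bool) :
    (0 <= c)%E -> (0 <= d)%E -> (0 <= if x then c else d)%E.
  by case: x.
have mk (c d c' d' : \bar R) :
    (0 <= c)%E -> (0 <= d)%E -> (0 <= c')%E -> (0 <= d')%E ->
    (pnorm p [:: c + c'; d + d'] <= pnorm p [:: c; d] + pnorm p [:: c'; d'])%E.
  move=> c0 d0 c'0 d'0.
  have := @minkowski_pnorm bool [:: true; false] (fun x => if x then c else d)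
    (fun x => if x then c' else d').
  by apply=> x; exact: ab0.
apply: (le_trans (mk _ _ _ _ a0 b0 _ _)); rewrite ?lee_fin//.
apply: leeD => //.
(* The remaining norm of [(e, e)] is at most that of [(e, 0)] plus that of [(0, e)]. *)
have := mk e%:E 0%E 0%E e%:E.
rewrite !adde0 !add0e !lee_fin => /(_ e0 (lexx _) (lexx _) e0) /le_trans; apply.
have e1 (v : \bar R) : v = 0%E -> pnorm p [:: e%:E; v] = e%:E.
  by move=> ->; rewrite (@pnorm_cat0 [:: e%:E]) pnorm_seq1// lee_fin.
rewrite EFinD; apply: leeD; first by rewrite e1.
by rewrite (pnorm_perm (permEl (perm_catC [:: 0%E] [:: e%:E]))) e1.
Qed.

End PNorm.

(** * Words up to a subset *)

(** The second components are carried along when the first ones are reordered;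
    this is how a permutation is applied to a coupling. *)
Lemma perm_unzip1 (T S : eqType) (l : seq (T * S)) (u : seq T) :
  perm_eq u (unzip1 l) -> exists2 l', perm_eq l' l & unzip1 l' = u.
Proof.
case: l => [|w l]; first by move=> /perm_nilP ->; exists [::].
case/(perm_iotaP w.1) => Is Isp ->; exists [seq nth w (w :: l) i | i <- Is].
  by apply/(perm_iotaP w); exists Is; rewrite // -(size_map fst).
rewrite /unzip1 -map_comp; apply/eq_in_map => i.
rewrite (perm_mem Isp) mem_iota /= add0n size_map => ilt.
by rewrite -(@nth_map _ w _ w.1 fst _ (w :: l)).
Qed.

Section Off.
Variables (X : choiceType) (A : set X).
Implicit Types (s t : seq X).

(** The entries that survive in [D(X, A)]. *)
Definition off s := [seq x <- s | x \notin A].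

Lemma off_cat s t : off (s ++ t) = off s ++ off t.
Proof. exact: filter_cat. Qed.

Lemma off_sub t : (forall x, x \in t -> A x) -> off t = [::].
Proof.
move=> tA; apply/eqP; rewrite -(negbK (_ == _)) -has_filter; apply/hasPn => x xt.
by rewrite negbK inE; exact: tA.
Qed.

Lemma off_catr s t : (forall x, x \in t -> A x) -> off (s ++ t) = off s.
Proof. by move=> tA; rewrite off_cat (off_sub tA) cats0. Qed.

Lemma perm_off_inA s : perm_eq s (off s ++ [seq x <- s | x \in A]).
Proof.
rewrite perm_sym /off (@eq_filter _ (fun x => x \in A) (predC (fun x => x \notin A))).
  exact/permEl/perm_filterC.
by move=> x /=; rewrite negbK.
Qed.

Lemma inA_sub s x : x \in [seq x <- s | x \in A] -> A x.
Proof. by rewrite mem_filter => /andP[/[!inE]]. Qed.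

(** After padding, both words contain the entries in [A] of the two words. *)
Lemma perm_off_pad s s' : perm_eq (off s) (off s') ->
  perm_eq (s ++ [seq x <- s' | x \in A]) (s' ++ [seq x <- s | x \in A]).
Proof.
move=> e; apply/seq.permP => q.
rewrite !count_cat (seq.permP (perm_off_inA s)) (seq.permP (perm_off_inA s')).
by rewrite !count_cat (seq.permP e) addnAC.
Qed.

Lemma seq_mset_cat s t : seq_mset (s ++ t) = (seq_mset s `+` seq_mset t)%mset.
Proof. by apply/msetP => x; rewrite msetE2 !mset_seqE count_cat. Qed.

(** The isomorphism of [D(X, A)] with the free commutative monoid on the
    complement of [A], as a criterion for words. *)
Lemma Dsum_eqP s s' : Dsum A s = Dsum A s' <-> perm_eq (off s) (off s').
Proof.
rewrite /Dsum Dpi_eqP; split=> [/asboolP[xi [eta [xiA etaA]]]|e].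
  rewrite -[xi]seq_mset_id -[eta]seq_mset_id -!seq_mset_cat => /eq_seq_msetP.
  move=> /(perm_filter (fun x => x \notin A)).
  rewrite -!/(off _) !off_catr//.
apply/asboolP; exists (seq_mset [seq x <- s' | x \in A]).
exists (seq_mset [seq x <- s | x \in A]).
have sub u : Dsub A (seq_mset [seq x <- u | x \in A]).
  by move=> x; rewrite (perm_mem (perm_eq_seq_mset _)); exact: inA_sub.
split=> //; rewrite -!seq_mset_cat; apply/eq_seq_msetP; exact: perm_off_pad.
Qed.

Lemma Dsum_repr (a : Dquot A) : Dsum A (repr a : {mset X}%mset) = a.
Proof. by rewrite /Dsum seq_mset_id reprK. Qed.

Lemma Dsum_cat s t : Dsum A (s ++ t) = Dsum A s + Dsum A t.
Proof. by rewrite /Dsum seq_mset_cat -Dadd_pi. Qed.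

Lemma Dsum_nil : Dsum A [::] = 0.
Proof.
rewrite /Dsum (_ : seq_mset [::] = mset0)//.
by apply/msetP => x; rewrite mset_seqE mset0E.
Qed.

End Off.

(** * Couplings and the Wasserstein distance *)

Section Couplings.
Variables (R : realType) (p : \bar R).
Hypothesis hp : (1 <= p)%E.
Variable X : metric_pair R.
Implicit Types (s t : seq X) (l : seq (X * X)).
Local Notation A := (psub X).
Local Notation d := (pdist X).
Local Notation W := (wasserstein_word p X).

Lemma pdist_ge0 x y : (0 <= d x y)%E.
Proof. by case: (pdistP X). Qed.

(** A matching in which any number of points of [A] may take part: only the
    entries outside [A] are prescribed. *)
Definition coupling s s' l : Prop :=
  perm_eq (off A (unzip1 l)) (off A s) /\ perm_eq (off A (unzip2 l)) (off A s').

Definition cost l : \bar R := pnorm p [seq d u.1 u.2 | u <- l].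

Definition diag t : seq (X * X) := [seq (x, x) | x <- t].

Lemma unzip1_diag t : unzip1 (diag t) = t.
Proof. by rewrite /unzip1 -map_comp map_id. Qed.

Lemma unzip2_diag t : unzip2 (diag t) = t.
Proof. by rewrite /unzip2 -map_comp map_id. Qed.

Lemma cost_diag t : cost (diag t) = 0%E.
Proof.
rewrite /cost -map_comp; apply: pnorm_map0 => // x /=.
by case: (pdistP X).
Qed.

Lemma cost_cat_diag l t : cost (l ++ diag t) = cost l.
Proof. by rewrite /cost map_cat pnorm_cat0//; exact: cost_diag. Qed.

Lemma cost_perm l l' : perm_eq l l' -> cost l = cost l'.
Proof. by move=> e; apply: pnorm_perm; exact: perm_map. Qed.

Lemma coupling_perm s s' l l' : perm_eq l l' -> coupling s s' l -> coupling s s' l'.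
Proof.
move=> e [h1 h2]; split.
  apply: (perm_trans _ h1); apply: perm_filter; apply: perm_map.
  by rewrite perm_sym.
apply: (perm_trans _ h2); apply: perm_filter; apply: perm_map.
by rewrite perm_sym.
Qed.

Lemma coupling_cat s1 s1' s2 s2' l1 l2 :
  coupling s1 s1' l1 -> coupling s2 s2' l2 ->
  coupling (s1 ++ s2) (s1' ++ s2') (l1 ++ l2).
Proof.
by move=> [h1 h2] [k1 k2]; split; rewrite /unzip1 /unzip2 map_cat !off_cat perm_cat.
Qed.

Lemma coupling_cat_diag s s' l t : (forall x, x \in t -> A x) ->
  coupling s s' l -> coupling s s' (l ++ diag t).
Proof.
move=> tA [h1 h2]; split; rewrite /unzip1 /unzip2 map_cat off_catr//.
  by rewrite -/(unzip1 (diag t)) unzip1_diag.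
by rewrite -/(unzip2 (diag t)) unzip2_diag.
Qed.

(** Dropping the pairs inside [A * A] leaves pairs that each contain an entry
    of [s] or of [s'] outside [A]; hence the bound on their number. *)
Lemma coupling_trim s s' l : coupling s s' l -> exists l',
  [/\ coupling s s' l', (cost l' <= cost l)%E &
      (size l' <= size (off A s) + size (off A s'))%N].
Proof.
pose q (u : X * X) := (u.1 \notin A) || (u.2 \notin A).
move=> [h1 h2]; exists (seq.filter q l); split.
- split; [apply: (perm_trans _ h1)|apply: (perm_trans _ h2)]; clear; rewrite /off;
    elim: l => //= -[x y] l ih; rewrite /q/=; case: (boolP (x \in A)) => /= xA;
    case: (boolP (y \in A)) => /= yA; rewrite /= ?xA ?yA ?perm_cons //=.
- rewrite /cost -[leRHS](@cost_perm (seq.filter q l ++ seq.filter (predC q) l)).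
    rewrite /cost map_cat; exact: le_pnorm_cat.
  exact/permPl/perm_filterC.
apply: (@leq_trans (size (off A (unzip1 l)) + size (off A (unzip2 l)))).
  rewrite /q; clear; elim: l => //= -[x y] l ih /=.
  case: (boolP (x \in A)) => /= xA; case: (boolP (y \in A)) => /= yA //=.
  - by rewrite addnS ltnS.
  - by rewrite addSn ltnS; apply: leq_trans ih _; rewrite addnS.
by rewrite (perm_size h1) (perm_size h2).
Qed.

(** Brings an arbitrary coupling to the shape used in the definition of the
    distance: [s] padded by [t] and [s'] padded by [t'], of common length
    [size s + size s']. *)
Lemma coupling_square s s' l : coupling s s' l -> exists l' t t',
  [/\ (forall x, x \in t -> A x) /\ (forall x, x \in t' -> A x),
      unzip1 l' = s ++ t, perm_eq (unzip2 l') (s' ++ t'),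
      size l' = (size s + size s')%N & (cost l' <= cost l)%E].
Proof.
move=> /coupling_trim[l1 [[c1 c2] le sz]].
have [a0 Aa0] := psub_neq0 X.
have inA_size u : size u = (size (off A u) + size [seq x <- u | x \in A])%N.
  by rewrite (perm_size (perm_off_inA A u)) size_cat.
(* The number of pairs missing to reach [size s + size s'] after every entry in
   [A] of both words has been matched with itself. This truncated difference is a
   true one by the bound on the size of [l1]. *)
pose k := (size s + size s' - (size l1 + size [seq x <- s | x \in A] +
  size [seq x <- s' | x \in A]))%N.
have nseqA x : x \in nseq k a0 -> A x by rewrite mem_nseq => /andP[_ /eqP ->].
pose v := [seq x <- s | x \in A] ++ [seq x <- s' | x \in A] ++ nseq k a0.
pose t := [seq x <- unzip1 l1 | x \in A] ++ [seq x <- s' | x \in A] ++ nseq k a0.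
pose t' := [seq x <- unzip2 l1 | x \in A] ++ [seq x <- s | x \in A] ++ nseq k a0.
have e1 : perm_eq (s ++ t) (unzip1 (l1 ++ diag v)).
  rewrite /unzip1 map_cat -/(unzip1 (diag v)) unzip1_diag; apply/seq.permP => q.
  rewrite /t /v !count_cat (seq.permP (perm_off_inA A s)).
  rewrite (seq.permP (perm_off_inA A (unzip1 l1)) q).
  by rewrite !count_cat (seq.permP c1) !addnA; congr (_ + _ + _)%N; exact: addnAC.
have e2 : perm_eq (unzip2 (l1 ++ diag v)) (s' ++ t').
  rewrite /unzip2 map_cat -/(unzip2 (diag v)) unzip2_diag; apply/seq.permP => q.
  rewrite /t' /v !count_cat (seq.permP (perm_off_inA A s')).
  rewrite (seq.permP (perm_off_inA A (unzip2 l1)) q).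
  rewrite !count_cat (seq.permP c2) !addnA; congr (_ + _)%N.
  by rewrite [LHS](addn.[ACl 1*4*2*3]).
have [l2 l2p u2] := perm_unzip1 e1.
exists l2, t, t'; split=> //.
- by split=> x; rewrite !mem_cat => /or3P[/inA_sub|/inA_sub|/nseqA].
- by apply: perm_trans e2; exact: perm_map.
- rewrite (perm_size l2p) !size_cat size_map !size_cat size_nseq !addnA subnKC//.
  by rewrite -addnA (inA_size s) (inA_size s') addnACA leq_add2r.
- by rewrite (cost_perm l2p) cost_cat_diag.
Qed.

(** Once the coupling has the shape [s ++ t] against [s' ++ t'], the permutation
    is read off from the order of its second components. *)
Lemma wasserstein_word_le s s' l : coupling s s' l -> (W s s' <= cost l)%E.
Proof.
move=> /coupling_square[l' [t [t' [[tA t'A] e1 e2 sz le]]]].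
apply: le_trans le; apply: ereal_inf_lbound.
have sz1 : size (s ++ t) == (size s + size s')%N by rewrite -e1 size_map sz.
have sz2 : size (s' ++ t') == (size s + size s')%N.
  by rewrite -(perm_size e2) size_map sz.
have [sigma Hs] : exists sigma : 'S_(size s + size s'),
    unzip2 l' = [tuple tnth (Tuple sz2) (sigma i) | i < size s + size s'].
  exact/tuple_permP.
exists t, t', (Tuple sz1), (Tuple sz2), sigma; split=> //.
rewrite /cost; congr pnorm.
move: sz => /eqP sz; pose L := Tuple sz.
have -> : [seq d u.1 u.2 | u <- l'] =
    [seq d (tnth L i).1 (tnth L i).2 | i <- enum 'I_(size s + size s')].
  by rewrite (map_comp (fun u => d u.1 u.2) (tnth L)) map_tnth_enum.
apply: eq_map => i; congr (d _ _).
  have -> : Tuple sz1 = [tuple of map fst L] by apply/val_inj; rewrite /= -e1.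
  by rewrite tnth_map.
transitivity (tnth [tuple of map snd L] i); first by rewrite tnth_map.
have -> : [tuple of map snd L] =
    [tuple tnth (Tuple sz2) (sigma i) | i < size s + size s'].
  by apply/val_inj; rewrite /= -Hs.
by rewrite tnth_mktuple.
Qed.

Lemma wasserstein_word_ge s s' c :
  (forall l, coupling s s' l -> (c <= cost l)%E) -> (c <= W s s')%E.
Proof.
move=> H; apply/ereal_infP => _ [t [t' [y [y' [sigma [[tA t'A] e1 e2 ->]]]]]].
pose l := [seq (tnth y k, tnth y' (sigma k)) | k <- enum 'I_(size s + size s')].
have -> : pnorm p [seq d (tnth y k) (tnth y' (sigma k))
    | k <- enum 'I_(size s + size s')] = cost l.
  by rewrite /cost /l -map_comp.
apply: H; split.
  have -> : unzip1 l = s ++ t by rewrite -e1 /l /unzip1 -map_comp; exact: map_tnth_enum.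
  by rewrite off_catr.
have : perm_eq (unzip2 l) (s' ++ t').
  rewrite -e2; apply/tuple_permP; exists sigma.
  by rewrite /l /unzip2 -map_comp.
by move=> /(perm_filter (fun x => x \notin A)); rewrite -!/(off _ _) off_catr.
Qed.

(** Since [A] may be infinite, the infimum need not be attained. *)
Lemma wasserstein_word_approx s s' (e : R) : 0 < e -> (W s s' < +oo)%E ->
  exists2 l, coupling s s' l & (cost l <= W s s' + e%:E)%E.
Proof.
move=> e0 fin; apply: contrapT => H.
have fW : W s s' \is a fin_num.
  rewrite ge0_fin_numE//; apply: wasserstein_word_ge => l _; exact: pnorm_ge0.
have : (W s s' + e%:E <= W s s')%E.
  apply: wasserstein_word_ge => l cl; rewrite leNgt; apply/negP => lt.
  by apply: H; exists l => //; exact: ltW.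
by rewrite leNgt lteDl// lte_fin e0.
Qed.

(** Two words with the same entries outside [A] have the same couplings. *)
Lemma wasserstein_word_congr s r s' r' :
  perm_eq (off A s) (off A r) -> perm_eq (off A s') (off A r') ->
  W s s' = W r r'.
Proof.
suff H s1 r1 s1' r1' : perm_eq (off A s1) (off A r1) -> perm_eq (off A s1') (off A r1') ->
    (W s1 s1' <= W r1 r1')%E.
  move=> h h'; apply/eqP; rewrite eq_le; apply/andP; split; apply: H => //;
  by rewrite perm_sym.
move=> h h'; apply: wasserstein_word_ge => l [c1 c2].
by apply: wasserstein_word_le; split; [rewrite (permPr h)|rewrite (permPr h')].
Qed.

Lemma wasserstein_Dsum s s' : wasserstein p X (Dsum A s) (Dsum A s') = W s s'.
Proof.
by apply: wasserstein_word_congr; apply/Dsum_eqP; rewrite Dsum_repr.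
Qed.

Lemma wasserstein_word_ge0 s s' : (0 <= W s s')%E.
Proof. by apply: wasserstein_word_ge => l _; exact: pnorm_ge0. Qed.

Lemma wasserstein_word_refl s : W s s = 0%E.
Proof.
apply/eqP; rewrite eq_le wasserstein_word_ge0 andbT -(cost_diag s).
by apply: wasserstein_word_le; split; rewrite ?unzip1_diag ?unzip2_diag.
Qed.

Lemma wasserstein_word_sym s s' : W s s' = W s' s.
Proof.
suff H s1 s2 : (W s1 s2 <= W s2 s1)%E by apply/eqP; rewrite eq_le !H.
apply: wasserstein_word_ge => l [c1 c2].
have -> : cost l = cost [seq (u.2, u.1) | u <- l].
  rewrite /cost -map_comp; congr pnorm; apply: eq_map => u /=.
  by case: (pdistP X).
apply: wasserstein_word_le; split.
  by rewrite /unzip1 -map_comp.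
by rewrite /unzip2 -map_comp.
Qed.

(** The two middle words agree only outside [A]. Padding each with the points
    of [A] occurring in the other, by diagonal pairs, makes them permutations of
    each other, and the couplings can then be composed entry by entry. *)
Lemma coupling_glue s s' s'' l1 l2 : coupling s s' l1 -> coupling s' s'' l2 ->
  exists2 l, coupling s s'' l & (cost l <= cost l1 + cost l2)%E.
Proof.
move=> c1 c2.
have mid : perm_eq (off A (unzip2 l1)) (off A (unzip1 l2)).
  by rewrite (permPl c1.2) perm_sym; exact: c2.1.
have := perm_off_pad mid.
set t1 := seq.filter _ _; set t2 := seq.filter _ (unzip2 l1) => e.
have [t1A t2A] : (forall x, x \in t1 -> A x) /\ (forall x, x \in t2 -> A x).
  by split=> x; exact: inA_sub.
have {}c1 := coupling_cat_diag t1A c1; have {}c2 := coupling_cat_diag t2A c2.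
rewrite -(cost_cat_diag l1 t1) -(cost_cat_diag l2 t2).
have {e} : perm_eq (unzip2 (l1 ++ diag t1)) (unzip1 (l2 ++ diag t2)).
  by rewrite /unzip1 /unzip2 !map_cat -/(unzip1 (diag _)) -/(unzip2 (diag _))
    unzip1_diag unzip2_diag.
move: (l1 ++ _) (l2 ++ _) c1 c2 => {mid t1 t2 t1A t2A l2}l1 l2 c1 c2.
move=> /perm_unzip1[l2' l2p e].
rewrite -(cost_perm l2p).
have {}c2 : coupling s' s'' l2' by apply: coupling_perm c2; rewrite perm_sym.
have sz : size l1 = size l2' by have := congr1 size e; rewrite !size_map.
(* The composable pairs of the two couplings, with [w.1.2 = w.2.1]. *)
pose m := zip l1 l2'.
have m1 : unzip1 m = l1 by rewrite unzip1_zip// sz.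
have m2 : unzip2 m = l2' by rewrite unzip2_zip// sz.
have mm w : w \in m -> w.1.2 = w.2.1.
  move: e; rewrite -{1}m2 -{1}m1 /unzip1 /unzip2 -!map_comp => /esym/eq_in_map.
  by move=> + wm => /(_ _ wm).
exists [seq (w.1.1, w.2.2) | w <- m].
  split.
    by rewrite /unzip1 -map_comp (map_comp fst fst) -/(unzip1 m) m1; case: c1.
  by rewrite /unzip2 -map_comp (map_comp snd snd) -/(unzip2 m) m2; case: c2.
rewrite -m1 -m2 /cost /unzip1 /unzip2 -!map_comp.
have := minkowski_pnorm hp m (fun w => pdist_ge0 w.1.1 w.1.2)
  (fun w => pdist_ge0 w.2.1 w.2.2).
apply: le_trans; apply: ler_pnorm => // w wm /=; first exact: pdist_ge0.
by rewrite -(mm w wm); case: (pdistP X).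
Qed.

Lemma wasserstein_word_triangle s s' s'' : (W s s'' <= W s s' + W s' s'')%E.
Proof.
have := wasserstein_word_ge0 s s'; have := wasserstein_word_ge0 s' s''.
have := @wasserstein_word_approx s s'; have := @wasserstein_word_approx s' s''.
case: (W s s') => [a| |] // + + + _; case: (W s' s'') => [b| |] // H2 H1 _;
  rewrite ?leey//.
apply/lee_addgt0Pr => e e0.
have e20 : 0 < e / 2 by rewrite divr_gt0.
have [l1 c1 k1] := H1 _ e20 (ltry _); have [l2 c2 k2] := H2 _ e20 (ltry _).
have [l c k] := coupling_glue c1 c2.
apply: le_trans (wasserstein_word_le c) _; apply: le_trans k _.
apply: le_trans (leeD k1 k2) _.
by rewrite -!EFinD lee_fin [in leRHS](splitr e) addrACA.
Qed.

Lemma wasserstein_word_cat s1 s2 s1' s2' :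
  (W (s1 ++ s2) (s1' ++ s2') <= pnorm p [:: W s1 s1'; W s2 s2'])%E.
Proof.
have W0 := wasserstein_word_ge0.
have infty a : a \in [:: W s1 s1'; W s2 s2'] -> a = +oo%E ->
    (W (s1 ++ s2) (s1' ++ s2') <= pnorm p [:: W s1 s1'; W s2 s2'])%E.
  move=> + ay; rewrite ay => /(le_mem_pnorm hp)/(_ (leey _)).
  by rewrite leye_eq => /eqP ->; exact: leey.
have [f1|] := boolP (W s1 s1' < +oo)%E; last first.
  rewrite -leNgt leye_eq => /eqP; apply: infty; exact: mem_head.
have [f2|] := boolP (W s2 s2' < +oo)%E; last first.
  by rewrite -leNgt leye_eq => /eqP; apply: infty; rewrite !inE eqxx orbT.
apply/lee_addgt0Pr => e e0.
have e20 : 0 < e / 2 by rewrite divr_gt0.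
(* Couplings within [e / 2] of the two infima cost together at most [e] more. *)
have [l1 c1 k1] := wasserstein_word_approx e20 f1.
have [l2 c2 k2] := wasserstein_word_approx e20 f2.
apply: le_trans (wasserstein_word_le (coupling_cat c1 c2)) _.
rewrite /cost map_cat pnorm_cat// [in leRHS](splitr e).
apply: le_trans (pnorm2D_le hp _ _ _); rewrite ?(ltW e20)//.
by apply: pnorm2_le => //; exact: pnorm_ge0.
Qed.

Lemma wasserstein_metric : is_metric (wasserstein p X).
Proof.
by split=> *; [exact: wasserstein_word_ge0|exact: wasserstein_word_refl|
  exact: wasserstein_word_sym|exact: wasserstein_word_triangle].
Qed.

Lemma wasserstein_subadditive : is_subadditive p (wasserstein p X).
Proof.
move=> a b a' b'; rewrite -[a]Dsum_repr -[b]Dsum_repr -[a']Dsum_repr -[b']Dsum_repr.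
by rewrite -!Dsum_cat !wasserstein_Dsum; exact: wasserstein_word_cat.
Qed.

End Couplings.

(** * Functoriality *)

Section Pushforward.
Variables (R : realType) (X Y : metric_pair R) (f : pair_hom X Y).

Lemma pair_hom_sub x : psub X x -> psub Y (f x).
Proof. by move=> Ax; apply: (@pair_fun_sub _ _ _ f); exists x. Qed.

(** Entries in [A] are mapped into [B], so they contribute nothing. *)
Lemma off_map s : off (psub Y) (map f s) = off (psub Y) (map f (off (psub X) s)).
Proof.
elim: s => //= x s ih; case: (boolP (x \in psub X)) => xA /=; last by rewrite ih.
by rewrite ifF// mem_set//; apply: pair_hom_sub; exact: set_mem.
Qed.

Lemma perm_off_map s s' : perm_eq (off (psub X) s) (off (psub X) s') ->
  perm_eq (off (psub Y) (map f s)) (off (psub Y) (map f s')).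
Proof.
by move=> e; rewrite off_map (off_map s'); apply: perm_filter; exact: perm_map.
Qed.

Lemma Dpush_Dsum s : Dpush f (Dsum (psub X) s) = Dsum (psub Y) (map f s).
Proof. by apply/Dsum_eqP/perm_off_map/Dsum_eqP; rewrite Dsum_repr. Qed.

Lemma Dpush_monoid_hom : is_monoid_hom (Dpush f).
Proof.
split=> [|a b]; first by rewrite -!Dsum_nil Dpush_Dsum.
rewrite -[a]Dsum_repr -[b]Dsum_repr -Dsum_cat !Dpush_Dsum map_cat.
exact: Dsum_cat.
Qed.

Lemma coupling_map s s' l : coupling s s' l ->
  coupling (map f s) (map f s') [seq (f u.1, f u.2) | u <- l].
Proof.
move=> [c1 c2]; split; rewrite /unzip1 /unzip2 -map_comp.
  by rewrite (map_comp f fst); exact: perm_off_map.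
by rewrite (map_comp f snd); exact: perm_off_map.
Qed.

Lemma Dpush_metric_map (p : \bar R) : (1 <= p)%E ->
  is_metric_map (wasserstein p X) (wasserstein p Y) (Dpush f).
Proof.
move=> hp a b; rewrite -[a]Dsum_repr -[b]Dsum_repr !Dpush_Dsum !wasserstein_Dsum//.
apply: wasserstein_word_ge => l /coupling_map/(wasserstein_word_le hp)/le_trans; apply.
rewrite /cost -map_comp; apply: ler_pnorm => // u _ /=; first exact: pdist_ge0.
exact: pair_fun_metric.
Qed.

End Pushforward.

(** * Extension of maps to formal sums *)

Section Extension.
Variables (R : realType) (p : \bar R).
Hypothesis hp : (1 <= p)%E.
Variables (X : metric_pair R) (M : metric_monoid p).

Lemma mdist_ge0 (a b : M) : (0 <= Defs.mdist M a b)%E.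
Proof. by case: (mdistP M). Qed.

(** Subadditivity, iterated along the sum by means of [pnorm_cat]. *)
Lemma mdist_sum_le (l : seq (M * M)) :
  (Defs.mdist M (\sum_(u <- l) u.1) (\sum_(u <- l) u.2) <=
   pnorm p [seq Defs.mdist M u.1 u.2 | u <- l])%E.
Proof.
elim: l => [|u l ih].
  by rewrite !big_nil; case: (mdistP M) => _ -> _ _; exact: pnorm_ge0.
rewrite !big_cons map_cons -cat1s pnorm_cat// pnorm_seq1 ?mdist_ge0//.
apply: le_trans (mdist_subadditive _ _ _ _) _.
by apply: pnorm2_le => //; exact: mdist_ge0.
Qed.

(** The extension of [g] to formal sums; it is a sum over a chosen representative,
    and [Dext_Dsum] removes the choice when [g] vanishes on [A]. *)
Definition Dext (g : X -> M) (a : Dquot (psub X)) : M :=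
  \sum_(x <- (repr a : {mset X}%mset)) g x.

Variable g : pair_hom X (U_obj M).

(** Terms in [A] vanish because [g] maps [A] to [0]. *)
Lemma sum_off s : \sum_(x <- s) (g x : M) = \sum_(x <- off (psub X) s) g x.
Proof.
rewrite big_filter [RHS]big_mkcond; apply: eq_bigr => x _.
case: (boolP (x \in psub X)) => //= /set_mem Ax.
exact: (pair_hom_sub g Ax).
Qed.

Lemma Dext_Dsum s : Dext g (Dsum (psub X) s) = \sum_(x <- s) g x.
Proof.
rewrite /Dext sum_off [RHS]sum_off; apply: perm_big.
by apply/Dsum_eqP; rewrite Dsum_repr.
Qed.

Lemma Dext_monoid_hom : is_monoid_hom (Dext g).
Proof.
split=> [|a b]; first by rewrite -Dsum_nil Dext_Dsum big_nil.
by rewrite -[a]Dsum_repr -[b]Dsum_repr -Dsum_cat !Dext_Dsum big_cat.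
Qed.

(** Points of [A] in a coupling do not change the sums, so a coupling of two
    words compares their images termwise. *)
Lemma Dext_metric_map : is_metric_map (wasserstein p X) (Defs.mdist M) (Dext g).
Proof.
move=> a b; rewrite -[a]Dsum_repr -[b]Dsum_repr wasserstein_Dsum// !Dext_Dsum.
apply: wasserstein_word_ge => l [c1 c2].
have sumE (u v : seq X) : perm_eq (off (psub X) u) (off (psub X) v) ->
    \sum_(x <- v) (g x : M) = \sum_(x <- u) g x.
  by move=> e; rewrite sum_off [RHS]sum_off; apply/esym/perm_big.
rewrite (sumE _ _ c1) (sumE _ _ c2) !big_map.
have := mdist_sum_le [seq (g u.1 : M, g u.2 : M) | u <- l].
rewrite !big_map => /le_trans; apply.
rewrite -map_comp; apply: ler_pnorm => // u _ /=; first exact: mdist_ge0.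
exact: (pair_fun_metric g).
Qed.

End Extension.

(** * The adjunction *)

Section Adjunction.
Variables (R : realType) (p : \bar R).
Hypothesis hp : (1 <= p)%E.

Lemma D_objects : D_objects_ok p.
Proof.
by move=> X; split; [exact: wasserstein_metric|exact: wasserstein_subadditive].
Qed.

Lemma D_morphisms : D_morphisms_ok p.
Proof.
by move=> X Y f; split; [exact: Dpush_metric_map|exact: Dpush_monoid_hom].
Qed.

Lemma D_laws :
  @functor_laws (MetPair R) (CMetMon p) (D_obj D_objects) (D_map D_objects D_morphisms).
Proof.
split=> [X|X Y Z g f]; apply: monoid_hom_ext; apply/funext => a /=.
  by rewrite -[a]Dsum_repr Dpush_Dsum map_id.
by rewrite -[a]Dsum_repr !Dpush_Dsum map_comp.
Qed.

Section Transpose.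
Variables (X : metric_pair R) (M : metric_monoid p).

Definition restrict_points (h : Dquot (psub X) -> M) (x : X) : M :=
  h (Dsum (psub X) [:: x]).

(** The one-pair list [(x, y)] is a coupling of the words [x] and [y]. *)
Lemma restrict_points_metric (h : monoid_hom (D_obj D_objects X) M) :
  is_metric_map (pdist X) (Defs.mdist M) (restrict_points h).
Proof.
move=> x y; apply: le_trans (monoid_fun_metric h _ _) _ => /=.
rewrite wasserstein_Dsum//.
have /(wasserstein_word_le hp)/le_trans : coupling [:: x] [:: y] [:: (x, y)] by [].
by apply; rewrite /cost pnorm_seq1//; exact: pdist_ge0.
Qed.

Lemma restrict_points_sub (h : monoid_hom (D_obj D_objects X) M) :
  restrict_points h @` psub X `<=` [set 0].
Proof.
move=> _ [x Ax <-]; rewrite /restrict_points /=.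
have -> : Dsum (psub X) [:: x] = 0.
  by rewrite -Dsum_nil; apply/Dsum_eqP; rewrite off_sub// => y /[!inE] /eqP ->.
exact: (monoid_funP h).1.
Qed.

Definition transpose (h : monoid_hom (D_obj D_objects X) M) : pair_hom X (U_obj M) :=
  @PairHom R X (U_obj M) _ (restrict_points_metric h) (@restrict_points_sub h).

Definition untranspose (g : pair_hom X (U_obj M)) : monoid_hom (D_obj D_objects X) M :=
  @MonoidHom R p (D_obj D_objects X) M _ (Dext_metric_map hp g) (Dext_monoid_hom g).

(** A homomorphism on [D(X, A)] is determined by its values on one-letter words. *)
Lemma transposeK : cancel transpose untranspose.
Proof.
move=> h; apply: monoid_hom_ext; apply/funext => a.
rewrite -[a]Dsum_repr [LHS]Dext_Dsum.
have [h0 hD] := monoid_funP h.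
elim: (repr a : seq X) => [|x s ih]; first by rewrite big_nil Dsum_nil.
by rewrite big_cons ih -cat1s Dsum_cat hD.
Qed.

Lemma untransposeK : cancel untranspose transpose.
Proof.
move=> g; apply: pair_hom_ext; apply/funext => x.
by rewrite [LHS]Dext_Dsum big_seq1.
Qed.

End Transpose.

Lemma D_left_adjoint : left_adjoint (Functor D_laws) (U p).
Proof.
exists transpose; split=> [X M|X X' M M' f g h].
  by exists (@untranspose X M); [exact: transposeK|exact: untransposeK].
apply: pair_hom_ext; apply/funext => x /=.
by rewrite /restrict_points /= Dpush_Dsum.
Qed.

End Adjunction.

Theorem theorem1p2 (R : realType) (p : \bar R) (hp : (1 <= p)%E) :
  (forall (X : metric_pair R) (s s' : seq X),
     wasserstein p X (Dsum (psub X) s) (Dsum (psub X) s') =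
     wasserstein_word p X s s') /\
  (forall (X Y : metric_pair R) (f : pair_hom X Y) (s : seq X),
     Dpush f (Dsum (psub X) s) = Dsum (psub Y) (map f s)) /\
  exists (H : D_objects_ok p) (K : D_morphisms_ok p)
         (L : @functor_laws (MetPair R) (CMetMon p) (D_obj H) (D_map H K)),
    left_adjoint (Functor L) (U p).
Proof.
split; first by move=> X; exact: wasserstein_Dsum.
split; first exact: Dpush_Dsum.
exists (D_objects hp), (D_morphisms hp), (D_laws hp); exact: D_left_adjoint.
Qed.
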